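(* Let $d\ge 2$, $1\le r\le d$, $N\ge 1$, let $\rho_r=\frac1r\sum_{i=1}^r|i\rangle\langle i|$ be the rank-$r$ state on $\mathbb{C}^d$ with equal non-zero eigenvalues, and let $\hat\rho_{\rm LS}$ be the least squares estimator computed from $N$ independent outcomes of the covariant measurement on $\rho_r$. Then $$ N\,\mathbb{E}\|\hat\rho_{\rm LS}-\rho_r\|_2^2=(r+1)(r+2)\frac{d+1}{d+2}-\frac{(r+1)^2}{r}+2\,\frac{(r+1)(d-r)(d+1)}{d+2}+\frac{(d-r)(d-r-1)(d+1)}{d+2}+\frac{(d-r)d}{d+2}. $$
   Context: $\{|i\rangle\}_{i=1}^d$ is the standard basis of $\mathbb{C}^d$; $\|X\|_2^2=\mathrm{Tr}(X^*X)$ is the squared Frobenius norm. The covariant measurement has outcomes in the space of one-dimensional orthogonal projections $P$ on $\mathbb{C}^d$, with positive operator valued measure $M(\mathrm{d}P)=d\cdot P\cdot\mathrm{d}P$, where $\mathrm{d}P$ is the unique unitarily invariant probability measure on one-dimensional projections. Thus when the state is $\rho$ the outcome has density $d\,\mathrm{Tr}(\rho P)$ with respect to $\mathrm{d}P$. Given independent outcomes $P_1,\dots,P_N$, the least squares estimator is $$\hat\rho_{\rm LS}=\frac{d+1}{N}\sum_{i=1}^N\Big(P_i-\frac{\mathbf 1}{d+1}\Big).$$ *)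

(* Defs.v *)
From HB Require Import structures.
From mathcomp Require Import all_boot all_order all_algebra.
From mathcomp Require Import all_classical all_reals all_analysis.
From mathcomp Require Import complex.

Set Implicit Arguments.
Unset Strict Implicit.
Unset Printing Implicit Defensive.

Import Order.TTheory GRing.Theory Num.Theory.
Import numFieldNormedType.Exports.

Local Open Scope classical_set_scope.
Local Open Scope ring_scope.
Local Open Scope sesquilinear_scope.

Section Projector.
Variables (R : realType) (d : nat).

Definition is_projector (P : 'M[R[i]]_d) : bool :=
  [&& P \is hermsymmx, P *m P == P & \rank P == 1%N].

(* The proof of [1 < d] is a parameter of the type because measurable types *)
(* must be inhabited; it plays no other role.                               *)
Record projector (d_gt1 : (1 < d)%N) : Type := Projector {
  projector_mx :> 'M[R[i]]_d;
  projectorP : is_projector projector_mx }.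

Variable d_gt1 : (1 < d)%N.
Local Notation proj := (projector d_gt1).

HB.instance Definition _ := [isSub of projector d_gt1 for @projector_mx d_gt1].
HB.instance Definition _ := [Choice of projector d_gt1 by <:].

Lemma is_projector_delta (i : 'I_d) : is_projector (delta_mx i i).
Proof.
apply/and3P; split; last by rewrite mxrank_delta.
  by rewrite is_hermitianmxE expr0 scale1r trmx_delta map_delta_mx.
by rewrite mul_delta_mx.
Qed.

HB.instance Definition _ := isPointed.Build (projector d_gt1)
  (Projector d_gt1 (is_projector_delta (Ordinal (ltnW d_gt1)))).

(* Traces on the set of projectors of the open sets of matrices: they generate *)
(* the Borel sigma-algebra. [R[i]^o] is [R[i]] with its usual topology.        *)
Definition projector_open : set (set proj) :=
  preimage_set_system [set: proj] (@projector_mx d_gt1)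
    (@open 'M[R[i]^o]_d).

HB.instance Definition _ := @isMeasurable.Build (sigma_display projector_open)
  (projector d_gt1) <<s projector_open >> (@sigma_algebra0 _ setT projector_open)
  (@sigma_algebraC _ projector_open) (@sigma_algebra_bigcup _ setT projector_open).

Lemma is_projector_conj (U : 'M[R[i]]_d) (P : proj) :
  U \is unitarymx -> is_projector (U *m P *m U^t*).
Proof.
move=> Uu; have /and3P[/is_hermitianmxP Ph /eqP PP /eqP Pr] := projectorP P.
rewrite expr0 scale1r in Ph.
apply/and3P; split.
- by rewrite is_hermitianmxE expr0 scale1r !trmx_mul !map_mxM trmxCK -mulmxA
    -{1}Ph.
- rewrite !mulmxA mulmxKtV // -(mulmxA U) PP //.
- rewrite mxrankMfree; last by rewrite row_free_unit unitarymx_unit ?trmxC_unitary.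
  rewrite -mxrank_tr trmx_mul mxrankMfree ?mxrank_tr ?Pr //.
  by rewrite row_free_unit unitmx_tr unitarymx_unit.
Qed.

Definition projector_conj (U : 'M[R[i]]_d) (Uu : U \is unitarymx)
  (P : proj) : proj := Projector d_gt1 (is_projector_conj P Uu).

Definition unitarily_invariant (mu : set proj -> \bar R) : Prop :=
  forall (U : 'M[R[i]]_d) (Uu : U \is unitarymx) (A : set proj),
    measurable A -> mu (projector_conj Uu @^-1` A) = mu A.

(* [Tr (rho P)] is real when [rho] is Hermitian, whence the real part. *)
Definition covariant_density (rho : 'M[R[i]]_d) (P : proj) : R :=
  d%:R * complex.Re (\tr (rho *m P)).

Definition covariant_law (mu : probability proj R) (rho : 'M[R[i]]_d)
    (A : set proj) : \bar R :=
  (\int[mu]_(P in A) (covariant_density rho P)%:E)%E.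

Definition ls_estimator (N : nat) (P : 'I_N -> proj) : 'M[R[i]]_d :=
  (d.+1%:R / N%:R) *: \sum_(i < N) (projector_mx (P i) - (d.+1%:R^-1)%:M).

Definition equal_rank_state (r : nat) : 'M[R[i]]_d :=
  r%:R^-1 *: \sum_(i < d | (i < r)%N) delta_mx i i.

(* [Tr (X^* X)] is a nonnegative real element of [R[i]]. *)
Definition frobenius_sq (X : 'M[R[i]]_d) : R := complex.Re (\tr (X^t* *m X)).

End Projector.

Definition mutually_independent d d' (T : measurableType d)
    (T' : measurableType d') (R : realType) (Pr : probability T R)
    (I : finType) (X : I -> {RV Pr >-> T'}) : Prop :=
  forall (J : {set I}) (A : I -> set T'), (forall i, measurable (A i)) ->
    Pr (\bigcap_(i in [set` J]) (X i @^-1` A i)) =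
    (\prod_(i in J) Pr (X i @^-1` A i))%E.

(* Main.v *)
(** The errors [Y_i = (d+1) P_i - 1 - rho] are independent, and centred because
    the second moments of the coordinates of a Haar-random projection give
    [E P_i = (1 + rho) / (d+1)].  The risk is therefore that of a single error,
    [E |(d+1) P - 1|^2 - |rho|^2 = d^2 + d - 1 - 1/r], which is the stated
    expression in closed form.

    The second moments follow from invariance under three kinds of unitaries.
    Phases on one coordinate kill [E (P_kk P_ab)] for [a <> b] and balance
    [Re P_ab] against [Im P_ab]; since [P] has rank one, [|P_ab|^2 = P_aa P_bb],
    so that [E (Re P_ab)^2 = E (P_aa P_bb) / 2].  A reflection mixing two
    coordinates then gives [E P_aa^2 = 2 E (P_aa P_bb)], and [tr P = 1]
    normalizes. *)
From HB Require Import structures.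
Require Import Defs.
From mathcomp Require Import all_boot all_order all_algebra.
From mathcomp Require Import all_classical all_reals all_analysis.
From mathcomp Require Import complex measurable_realfun ring lra.

Import Order.TTheory GRing.Theory Num.Theory.
Import numFieldNormedType.Exports.

Local Open Scope classical_set_scope.
Local Open Scope ring_scope.

(** * Bounded measurable functions and their means *)

Section BoundedMeasurable.
Context {dsp : measure_display} {T : measurableType dsp} {R : realType}.
Implicit Types f g : T -> R.

(** This class is stable under sums and products and integrable for every probability measure, so
    linearity of the mean never calls for a separate integrability argument. *)
Definition bounded_measurable f :=
  measurable_fun setT f /\ exists M, forall x, `|f x| <= M.

Lemma bounded_measurable_cst c : bounded_measurable (fun=> c).
Proof. by split; [exact: measurable_cst|exists `|c|]. Qed.

Lemma bounded_measurableD f g : bounded_measurable f -> bounded_measurable g ->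
  bounded_measurable (fun x => f x + g x).
Proof.
move=> [mf [M fM]] [mg [K gK]]; split; first exact: measurable_funD.
by exists (M + K) => x; rewrite (le_trans (ler_normD _ _))// lerD.
Qed.

Lemma bounded_measurableM f g : bounded_measurable f -> bounded_measurable g ->
  bounded_measurable (fun x => f x * g x).
Proof.
move=> [mf [M fM]] [mg [K gK]]; split; first exact: measurable_funM.
by exists (M * K) => x; rewrite normrM ler_pM.
Qed.

Lemma bounded_measurableZ c f : bounded_measurable f ->
  bounded_measurable (fun x => c * f x).
Proof. exact/bounded_measurableM/bounded_measurable_cst. Qed.

Lemma bounded_measurableB f g : bounded_measurable f -> bounded_measurable g ->
  bounded_measurable (fun x => f x - g x).
Proof.
move=> bf bg; have -> : (fun x => f x - g x) = (fun x => f x + -1 * g x).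
  by apply/funext => x; rewrite mulN1r.
exact/bounded_measurableD/bounded_measurableZ.
Qed.

Lemma bounded_measurable_sum (I : Type) (s : seq I) (Q : pred I)
    (F : I -> T -> R) : (forall i, bounded_measurable (F i)) ->
  bounded_measurable (fun x => \sum_(i <- s | Q i) F i x).
Proof.
move=> bF; elim: s => [|i s IHs].
  rewrite (_ : (fun=> _) = fun=> 0); first exact: bounded_measurable_cst.
  by apply/funext => x; rewrite big_nil.
have [Qi|nQi] := boolP (Q i); last first.
  rewrite (_ : (fun=> _) = fun x => \sum_(j <- s | Q j) F j x) //.
  by apply/funext => x; rewrite big_cons (negbTE nQi).
rewrite (_ : (fun=> _) = fun x => F i x + \sum_(j <- s | Q j) F j x).
  exact: bounded_measurableD.
by apply/funext => x; rewrite big_cons Qi.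
Qed.

Section Mean.
Variable P : probability T R.

Lemma bounded_measurable_integrable f : bounded_measurable f ->
  P.-integrable setT (EFin \o f).
Proof.
move=> [mf [M fM]]; apply: measurable_bounded_integrable => //.
  by rewrite -ge0_fin_numE// fin_num_measure.
exists M; split; first by rewrite num_real.
by move=> K MK x _ /=; rewrite (le_trans (fM x))// ltW.
Qed.

Lemma mean_EFin f : bounded_measurable f ->
  (\int[P]_x (f x)%:E)%E = (\int[P]_x f x)%:E.
Proof.
move=> bf; rewrite /Rintegral fineK//.
exact/integrable_fin_num/bounded_measurable_integrable.
Qed.

Lemma mean_cst c : \int[P]_x c = c.
Proof.
rewrite Rintegral_cst// [X in fine X](_ : _ = 1%E) ?mulr1//.
exact: probability_setT.
Qed.

Lemma meanD f g : bounded_measurable f -> bounded_measurable g ->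
  \int[P]_x (f x + g x) = \int[P]_x f x + \int[P]_x g x.
Proof. by move=> *; rewrite RintegralD//; exact: bounded_measurable_integrable. Qed.

Lemma meanB f g : bounded_measurable f -> bounded_measurable g ->
  \int[P]_x (f x - g x) = \int[P]_x f x - \int[P]_x g x.
Proof. by move=> *; rewrite RintegralB//; exact: bounded_measurable_integrable. Qed.

Lemma meanZ c f : bounded_measurable f ->
  \int[P]_x (c * f x) = c * \int[P]_x f x.
Proof. by move=> *; rewrite RintegralZl//; exact: bounded_measurable_integrable. Qed.

Lemma mean_sum (I : Type) (s : seq I) (Q : pred I) (F : I -> T -> R) :
  (forall i, bounded_measurable (F i)) ->
  \int[P]_x (\sum_(i <- s | Q i) F i x) = \sum_(i <- s | Q i) \int[P]_x F i x.
Proof.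
move=> bF; elim: s => [|i s IHs].
  rewrite big_nil -[RHS]mean_cst; apply: eq_Rintegral => x _.
  by rewrite big_nil.
have [Qi|nQi] := boolP (Q i).
  rewrite big_cons Qi -IHs -meanD//; last exact: bounded_measurable_sum.
  by apply: eq_Rintegral => x _; rewrite big_cons Qi.
rewrite big_cons (negbTE nQi) -IHs.
by apply: eq_Rintegral => x _; rewrite big_cons (negbTE nQi).
Qed.

End Mean.
End BoundedMeasurable.

(** * Image laws *)

Section Transfer.
Context {d d' : measure_display} {T : measurableType d} {T' : measurableType d'}.
Context {R : realType}.

Lemma bounded_measurable_comp (X : T -> T') (f : T' -> R) :
  measurable_fun setT X -> bounded_measurable f ->
  bounded_measurable (fun x => f (X x)).
Proof.
move=> mX [mf [M fM]]; split; last by exists M => x.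
exact: (measurableT_comp mf).
Qed.

Lemma mean_distribution (P : probability T R) (X : {RV P >-> T'}) (f : T' -> R) :
  bounded_measurable f -> \int[P]_x f (X x) = \int[distribution P X]_y f y.
Proof.
move=> bf; rewrite /Rintegral integral_distribution//.
  by case: bf => mf _; exact/measurable_EFinP.
apply: (bounded_measurable_integrable P (fun x => f (X x))).
exact: bounded_measurable_comp.
Qed.

End Transfer.

(** * Means of products of independent variables *)

Section Independence.
Context {d d' : measure_display} {T : measurableType d} {T' : measurableType d'}.
Context {R : realType}.

(* The pair [(X, Y)] has law the product of the marginals, by uniqueness of *)
(* the product measure on rectangles; Fubini then splits the mean.         *)
Lemma mean_mul_indep (P : probability T R) (X Y : {RV P >-> T'}) (f g : T' -> R) :
  (forall A B, measurable A -> measurable B ->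
    P (X @^-1` A `&` Y @^-1` B) = (P (X @^-1` A) * P (Y @^-1` B))%E) ->
  bounded_measurable f -> bounded_measurable g ->
  \int[P]_x (f (X x) * g (Y x)) = (\int[P]_x f (X x)) * \int[P]_x g (Y x).
Proof.
move=> XY bf bg.
have mXY : measurable_fun setT (fun x => (X x, Y x)).
  exact/measurable_fun_pair.
pose XYm := isMeasurableFun.Build _ _ _ _ _ mXY.
pose Z : {RV P >-> (T' * T')%type} := HB.pack (fun x => (X x, Y x)) XYm.
pose h (z : (T' * T')%type) := f z.1 * g z.2.
have bh : bounded_measurable h.
  apply: (bounded_measurableM (fun z => f z.1) (fun z => g z.2)).
    exact: (bounded_measurable_comp fst f measurable_fst).
  exact: (bounded_measurable_comp snd g measurable_snd).
rewrite (mean_distribution P Z h)//.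
rewrite (mean_distribution P X)// (mean_distribution P Y)//.
set m1 := distribution P X; set m2 := distribution P Y.
have int_h : (m1 \x m2)%E.-integrable setT (EFin \o h).
  exact: bounded_measurable_integrable.
have -> : \int[distribution P Z]_y h y = \int[(m1 \x m2)%E]_y h y.
  congr fine; apply/esym; apply: eq_measure_integral => A mA _.
  by apply: product_measure_unique => // B C mB mC; exact: XY.
rewrite {1}/Rintegral -(integral12_prod_meas1 int_h) /fubini_F /=.
rewrite (eq_integral (fun x => (\int[m2]_y g y * f x)%:E)); last first.
  move=> x _; rewrite /h /= (mean_EFin m2 (fun y => f x * g y)).
    by rewrite (meanZ m2 (f x) g)// mulrC.
  exact: bounded_measurableZ.
by rewrite -[LHS]/(\int[m1]_x (\int[m2]_y g y * f x)) meanZ// mulrC.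
Qed.

End Independence.

(** * Change of measure by a bounded density *)

Section Density.
Context {d : measure_display} {T : measurableType d} {R : realType}.

(** Null sets of [mu] are null for [nu], so [nu] has a Radon-Nikodym derivative. It has the same
    integral as [h] over every measurable set, hence equals [h] almost everywhere. *)
Lemma mean_density (mu nu : probability T R) (h f : T -> R) :
  bounded_measurable h ->
  (forall A, measurable A -> nu A = (\int[mu]_(x in A) (h x)%:E)%E) ->
  bounded_measurable f -> \int[nu]_x f x = \int[mu]_x (f x * h x).
Proof.
move=> bh nuE bf.
have numu : nu `<< mu.
  apply/null_content_dominatesP => A mA muA0; rewrite nuE//.
  apply: null_set_integral => //.
  by apply: measurable_funTS; apply/measurable_EFinP; case: bh.
have int_f := bounded_measurable_integrable nu f bf.
congr fine; rewrite -(Radon_Nikodym_change_of_variables numu measurableT int_f).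
have int_h := bounded_measurable_integrable mu h bh.
have int_rn : mu.-integrable setT
    (Radon_Nikodym (charge_of_finite_measure nu) mu).
  exact: Radon_Nikodym_integrable.
apply: ae_eq_integral => //.
- apply: emeasurable_funM; last exact: measurable_int int_rn.
  by apply/measurable_EFinP; case: bf.
- apply/measurable_EFinP; exact: (bounded_measurableM f h bf bh).1.
- under [X in ae_eq _ _ _ X]eq_fun do rewrite EFinM.
  apply: ae_eqe_mul2l.
  apply: integral_ae_eq => //.
  + by apply/measurable_EFinP; case: bh.
  + by move=> E _ mE; rewrite -Radon_Nikodym_integral//; exact: nuE.
Qed.

End Density.

(** * Continuity of real and imaginary parts and of matrix products *)

Section MatrixContinuity.
Variable R : realType.
Local Notation C := (R[i]^o).

Lemma continuous_Re : continuous (fun z : C => complex.Re z : R^o).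
Proof.
move=> z A /nbhs_ballP[e /= e0 eA]; apply/nbhs_ballP.
exists e%:C%C => /=; first by rewrite ltcR.
move=> t /= zt; apply: eA; rewrite /ball /= -raddfB /= -ltcR.
by apply: le_lt_trans zt; exact: normc_ge_Re.
Qed.

Lemma continuous_Im : continuous (fun z : C => complex.Im z : R^o).
Proof.
move=> z A /nbhs_ballP[e /= e0 eA]; apply/nbhs_ballP.
exists e%:C%C => /=; first by rewrite ltcR.
(* [Im z] is minus the real part of [z * 'i], and ['i] has modulus one, so the bound for real parts
   applies. *)
move=> t /= zt; apply: eA; rewrite /ball /= -raddfB /= -normrN -ReiNIm -ltcR.
apply: le_lt_trans zt; apply: le_trans (normc_ge_Re _) _.
rewrite normrM [X in _ * X](_ : _ = 1) ?mulr1// normc_def /=.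
by rewrite expr0n expr1n add0r sqrtr1.
Qed.

Lemma continuous_mulmx_mulmx (m n p q : nat) (U : 'M[R[i]]_(m, n))
    (V : 'M[R[i]]_(p, q)) :
  continuous (fun M : 'M[C]_(n, p) => U *m M *m V : 'M[C]_(m, q)).
Proof.
move=> M A /nbhs_ballP[e /= e0 eA]; apply/nbhs_ballP.
(* [s i j] is a Lipschitz constant of the entry [(i, j)] for the entrywise sup distance, and [S]
   bounds them all. Dividing by [S + 1] keeps the radius meaningful when [S] is zero. *)
pose s i j := \sum_l \sum_k `|U i k| * `|V l j|.
pose S := \sum_i \sum_j s i j.
have s_ge0 i j : 0 <= s i j.
  by apply: sumr_ge0 => l _; apply: sumr_ge0 => k _; exact: mulr_ge0.
have sS i j : s i j <= S.
  rewrite /S (bigD1 i)//= (bigD1 j)//= -addrA lerDl addr_ge0 ?sumr_ge0//.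
  by move=> k _; rewrite sumr_ge0.
have S1 : 0 < S + 1.
  by rewrite ltr_wpDl// /S sumr_ge0// => i _; rewrite sumr_ge0.
have d0 : 0 < e / (S + 1) by rewrite divr_gt0.
exists (e / (S + 1)) => // N /= [_ MN]; apply: eA; split => // i j.
rewrite /ball /= -[X in `|X|](_ : (U *m (M - N) *m V) i j = _); last first.
  by rewrite mulmxBr mulmxBl !mxE.
apply: (@le_lt_trans _ _ (s i j * (e / (S + 1)))); last first.
  rewrite mulrCA gtr_pMr// ltr_pdivrMr// mul1r.
  by rewrite (le_lt_trans (sS i j))// ltrDl.
rewrite mxE (le_trans (ler_norm_sum _ _ _))// mulr_suml ler_sum// => l _.
rewrite normrM mxE mulr_suml.
apply: le_trans (ler_wpM2r (normr_ge0 _) (ler_norm_sum _ _ _)) _.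
rewrite mulr_suml ler_sum// => k _.
rewrite normrM mulrAC ler_wpM2l ?mulr_ge0// !mxE.
exact/ltW/MN.
Qed.
End MatrixContinuity.

(** * Measurable maps on the space of projectors *)

Section ProjectorMeasurability.
Variables (R : realType) (d : nat) (d_gt1 : (1 < d)%N).
Local Notation proj := (projector R d_gt1).

(** Open rays generate the Borel sets of the line, and their preimages under a continuous function
    of matrices are open, so their traces are generators of the sigma-algebra on projectors. *)
Lemma projector_mx_measurable (g : 'M[R[i]^o]_d -> R^o) : continuous g ->
  measurable_fun setT (fun P : proj => g (projector_mx P) : R).
Proof.
move=> cg; apply: (measurability _ (RGenOInfty.measurableE R)).
move=> /= _ [_ [a ->]] <-; rewrite setTI; apply: sub_sigma_algebra.
exists (g @^-1` `]a, +oo[%classic); last by rewrite setTI.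
by apply: open_comp; [move=> x _; exact: cg|exact: interval_open].
Qed.

Lemma projector_conj_measurable (U : 'M[R[i]]_d) (Uu : U \is unitarymx) :
  measurable_fun setT (projector_conj Uu : proj -> proj).
Proof.
apply: (@measurability _ _ proj proj setT _ (@projector_open R d d_gt1)) => //.
move=> /= _ [_ [V oV <-] <-]; rewrite !setTI; apply: sub_sigma_algebra.
pose h (M : 'M[R[i]^o]_d) : 'M[R[i]^o]_d := U *m M *m (map_mx Num.conj U^T).
exists (h @^-1` V); last by rewrite setTI.
by apply: (@open_comp _ _ h V) => // x _; exact: continuous_mulmx_mulmx.
Qed.

End ProjectorMeasurability.

(** * Real coordinates of a rank-one projector *)

Section ProjectorEntries.
Context {R : realType} {d : nat} {d_gt1 : (1 < d)%N}.
Implicit Types (P : projector R d_gt1) (a b : 'I_d).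

Definition proj_re P a b : R := complex.Re (projector_mx P a b).
Definition proj_im P a b : R := complex.Im (projector_mx P a b).

Lemma projector_mxE P a b :
  projector_mx P a b = (proj_re P a b +i* proj_im P a b)%C.
Proof. by rewrite /proj_re /proj_im; case: (projector_mx P a b). Qed.

Lemma projector_mxC P a b : projector_mx P b a = (projector_mx P a b)^*.
Proof.
have /and3P[/is_hermitianmxP Ph _ _] := projectorP P.
by rewrite {1}Ph expr0 scale1r !mxE.
Qed.

Lemma proj_reC P a b : proj_re P b a = proj_re P a b.
Proof. by rewrite /proj_re (projector_mxC P a b); case: (projector_mx P a b). Qed.

Lemma proj_imC P a b : proj_im P b a = - proj_im P a b.
Proof. by rewrite /proj_im (projector_mxC P a b); case: (projector_mx P a b). Qed.

Lemma proj_im_diag P a : proj_im P a a = 0.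
Proof. by have := proj_imC P a a; lra. Qed.

(** In a rank-one factorization [P = u *m v], the product [v *m u] is a scalar [c], which is also
    the trace. Idempotence gives [(c - 1) P = 0], and [P] is nonzero because its rank is one. *)
Lemma projector_outer P :
  exists u : 'cV[R[i]]_d, exists v : 'rV[R[i]]_d,
    projector_mx P = u *m v /\ \tr (projector_mx P) = 1.
Proof.
have /and3P[_ /eqP PP /eqP rP] := projectorP P.
have := mulmx_base (projector_mx P).
move: (col_base _) (row_base _); rewrite rP => u v uv; exists u, v; split=> //.
rewrite -uv mxtrace_mulC trace_mx11; set c := (v *m u) 0 0.
have vu : v *m u = c%:M by rewrite [LHS]mx11_scalar.
have : (c - 1) *: projector_mx P = 0.
  rewrite scalerBl scale1r -{2}PP -uv mulmxA -(mulmxA u) vu mul_mx_scalar.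
  by rewrite scalemxAl subrr.
move/eqP; rewrite scaler_eq0 => /orP[|/eqP P0]; first by rewrite subr_eq0 => /eqP.
by move: rP; rewrite P0 mxrank0.
Qed.

Lemma proj_re_sum P : \sum_a proj_re P a a = 1.
Proof.
have [_ [_ [_ /(congr1 (@complex.Re R))]]] := projector_outer P.
by rewrite /mxtrace raddf_sum.
Qed.

(** The 2 by 2 minors of a rank-one matrix vanish, so [P_ab P_ba = P_aa P_bb]; the left side is
    [|P_ab|^2] because [P] is Hermitian. *)
Lemma proj_re_im_sqr P a b :
  proj_re P a b ^+ 2 + proj_im P a b ^+ 2 = proj_re P a a * proj_re P b b.
Proof.
have [u [v [Puv _]]] := projector_outer P.
have PE i j : projector_mx P i j = u i 0 * v 0 j by rewrite Puv mxE big_ord1.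
have : projector_mx P a b * projector_mx P b a =
       projector_mx P a a * projector_mx P b b by rewrite !PE; ring.
rewrite !projector_mxE (proj_reC P a b) (proj_imC P a b) !proj_im_diag.
by case=> + _; lra.
Qed.

(** Multiplying [P_aa] by the trace, which is 1, writes it as the sum of the [|P_ab|^2] over [b]. *)
Lemma proj_re_ge0 P a : 0 <= proj_re P a a.
Proof.
rewrite -[leRHS]mulr1 -(proj_re_sum P) mulr_sumr sumr_ge0// => b _.
by rewrite -proj_re_im_sqr addr_ge0 ?sqr_ge0.
Qed.

Lemma proj_re_le1 P a : proj_re P a a <= 1.
Proof.
rewrite -(proj_re_sum P) (bigD1 a)//= lerDl sumr_ge0// => b _.
exact: proj_re_ge0.
Qed.

Lemma proj_re_im_le1 P a b : proj_re P a b ^+ 2 + proj_im P a b ^+ 2 <= 1.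
Proof.
by rewrite proj_re_im_sqr mulr_ile1 ?proj_re_ge0 ?proj_re_le1.
Qed.

Lemma proj_re_bounded a b : bounded_measurable (fun P => proj_re P a b).
Proof.
split.
  apply: (projector_mx_measurable R d d_gt1 (fun M => complex.Re (M a b))).
  by move=> M; apply: continuous_comp; [exact: coord_continuous|exact: continuous_Re].
exists 1 => P; have := proj_re_im_le1 P a b; rewrite ler_norml.
by move: (proj_re P a b) (proj_im P a b) => x y; nra.
Qed.

Lemma proj_im_bounded a b : bounded_measurable (fun P => proj_im P a b).
Proof.
split.
  apply: (projector_mx_measurable R d d_gt1 (fun M => complex.Im (M a b))).
  by move=> M; apply: continuous_comp; [exact: coord_continuous|exact: continuous_Im].
exists 1 => P; have := proj_re_im_le1 P a b; rewrite ler_norml.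
by move: (proj_re P a b) (proj_im P a b) => x y; nra.
Qed.

End ProjectorEntries.

(** * Diagonal phases and rational reflections *)

Section Unitaries.
Context {R : realType} {d : nat}.
Local Open Scope sesquilinear_scope.

Definition phase_mx (a : 'I_d) (z : R[i]) : 'M[R[i]]_d :=
  diag_mx (\row_j (if j == a then z else 1)).

Lemma phase_mx_unitary a z : z * z^* = 1 -> phase_mx a z \is unitarymx.
Proof.
move=> z1; apply/unitarymxP/matrixP => i j.
rewrite /phase_mx mul_diag_mx !mxE.
have [->|_] := eqVneq j i; last by rewrite mulr0n rmorph0 mulr0.
by rewrite -[_ *+ true]/(_ *+ 1) mulr1n; case: ifP => _; rewrite ?z1 ?rmorph1 ?mulr1.
Qed.

Lemma phase_mx_conjE a z (M : 'M[R[i]]_d) i j :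
  (phase_mx a z *m M *m (phase_mx a z)^t*) i j =
  (if i == a then z else 1) * M i j * (if j == a then z else 1)^*.
Proof.
rewrite /phase_mx mul_diag_mx -[_^t*]/(map_mx _ _) tr_diag_mx map_diag_mx.
by rewrite mul_mx_diag !mxE.
Qed.

(* The reflection along [e_a + 2 e_b]: its row [a] is [(3/5) e_a - (4/5) e_b], *)
(* so that it mixes the coordinates [a] and [b] without any square root.      *)
Definition reflection_vec (a b : 'I_d) : 'cV[R[i]]_d := delta_mx a 0 + 2 *: delta_mx b 0.
Definition reflection_mx (a b : 'I_d) : 'M[R[i]]_d :=
  1%:M - (2 / 5) *: (reflection_vec a b *m (reflection_vec a b)^T).

(** The squared length is [1 + 2^2], which makes [2 / 5] the coefficient of a Householder
    reflection. *)
Lemma reflection_vec_norm a b : a != b ->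
  (reflection_vec a b)^T *m reflection_vec a b = 5%:M.
Proof.
move=> ab; rewrite /reflection_vec [(_ + _)^T]linearD /= [(2 *: _)^T]linearZ /= !trmx_delta.
rewrite mulmxDl !mulmxDr -!scalemxAl -!scalemxAr !mul_delta_mx_cond.
rewrite !eqxx (eq_sym b a) (negbTE ab) -![_ *+ true]/(_ *+ 1) -![_ *+ false]/(_ *+ 0).
rewrite !mulr0n !mulr1n !scaler0 addr0 add0r.
apply/matrixP => i j; rewrite !mxE !ord1 !eqxx /=; ring.
Qed.

Lemma reflection_mx_adj a b : (reflection_mx a b)^t* = reflection_mx a b.
Proof.
apply/matrixP => i j; rewrite !mxE !big_ord1 !mxE !rmorphB !rmorphM !rmorphD !rmorphM /=.
rewrite !fmorphV !rmorph_nat (eq_sym i j).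
by rewrite rmorph1; ring.
Qed.

(** With [A = v *m v^T] one has [A^2 = 5 A], so in the square of [1 - (2/5) A] the terms [- (4/5) A]
    and [(4/25) A^2] cancel. *)
Lemma reflection_mx_unitary a b : a != b -> reflection_mx a b \is unitarymx.
Proof.
move=> ab; apply/unitarymxP; rewrite reflection_mx_adj /reflection_mx.
set v := reflection_vec a b; set A := v *m v^T.
have AA : A *m A = 5 *: A.
  by rewrite /A mulmxA -(mulmxA v) reflection_vec_norm// mul_mx_scalar scalemxAl.
rewrite mulmxBl !mulmxBr !mul1mx mulmx1 -scalemxAl -scalemxAr AA !scalerA.
rewrite opprB addrACA -[RHS]addr0 -addrA; congr (_ + _).
rewrite addrA -!scaleNr -!scalerDl (_ : _ + _ = 0) ?scale0r//.
by field.
Qed.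

Lemma reflection_mx_row a b (F : 'I_d -> R[i]) : a != b ->
  \sum_k reflection_mx a b a k * F k = (3 / 5) * F a - (4 / 5) * F b.
Proof.
move=> ab; rewrite (bigD1 a)//= (bigD1 b) 1?eq_sym//= big1 ?addr0.
  rewrite !mxE !big_ord1 !mxE !eqxx (negbTE ab) eq_sym (negbTE ab) /=.
  by field.
move=> k /andP[ka kb]; rewrite !mxE !big_ord1 !mxE (negbTE ka) (negbTE kb).
by rewrite eq_sym (negbTE ka) /= !(mulr0, addr0, subr0, mul0r).
Qed.

Lemma reflection_mx_conjE a b (M : 'M[R[i]]_d) : a != b ->
  (reflection_mx a b *m M *m (reflection_mx a b)^t*) a a =
  9 / 25 * M a a + 16 / 25 * M b b - 12 / 25 * (M a b + M b a).
Proof.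
move=> ab; rewrite reflection_mx_adj.
have symW k : reflection_mx a b k a = reflection_mx a b a k.
  by rewrite !mxE !big_ord1 !mxE eq_sym [X in _ - _ * X]mulrC.
rewrite mxE; under eq_bigr do rewrite symW mulrC.
rewrite reflection_mx_row// !mxE !reflection_mx_row//.
by field.
Qed.

End Unitaries.

(** * Second moments under the invariant measure *)

Section Moments.
Context {R : realType} {d : nat} {d_gt1 : (1 < d)%N}.
Local Notation proj := (projector R d_gt1).
Variable mu : probability (proj) R.
Hypothesis mu_inv : unitarily_invariant mu.
Implicit Types (a b k : 'I_d) (f : proj -> R).

Local Notation x a P := (proj_re P a a).

Lemma mean_projector_conj (U : 'M[R[i]]_d) (Uu : U \is unitarymx) f :
  bounded_measurable f ->
  \int[mu]_P f (projector_conj Uu P) = \int[mu]_P f P.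
Proof.
move=> bf; have mU := projector_conj_measurable R d d_gt1 U Uu.
pose Um := isMeasurableFun.Build _ _ _ _ _ mU.
pose Z : {RV mu >-> proj} := HB.pack (projector_conj Uu) Um.
rewrite (mean_distribution mu Z f)//; congr fine.
by apply: eq_measure_integral => A mA _; exact: mu_inv.
Qed.

(* The last two arguments of [h] become the real and imaginary parts of [z P_ab]. *)
Lemma mean_phase a b k (z : R[i]) (z1 : z * z^* = 1) (h : R -> R -> R -> R) :
  a != b ->
  bounded_measurable (fun P : proj => h (x k P) (proj_re P a b) (proj_im P a b)) ->
  \int[mu]_P h (x k P) (proj_re P a b) (proj_im P a b) =
  \int[mu]_P h (x k P)
    (complex.Re z * proj_re P a b - complex.Im z * proj_im P a b)
    (complex.Re z * proj_im P a b + complex.Im z * proj_re P a b).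
Proof.
move=> ab bh; rewrite -(mean_projector_conj _ (phase_mx_unitary a z z1))//.
apply: eq_Rintegral => P _; set Q := projector_conj _ P.
have Qkk : projector_mx Q k k = projector_mx P k k.
  rewrite [LHS]phase_mx_conjE; case: ifP => _.
    by rewrite mulrAC z1 mul1r.
  by rewrite rmorph1 mul1r mulr1.
have Qab : projector_mx Q a b = z * projector_mx P a b.
  by rewrite [LHS]phase_mx_conjE eqxx eq_sym (negbTE ab) rmorph1 mulr1.
rewrite /proj_re /proj_im Qkk Qab.
by case: z {z1 bh Q Qkk Qab} => zr zi; case: (projector_mx P a b) => pr pi /=.
Qed.

Lemma bounded_measurable_diag_re k a b :
  bounded_measurable (fun P : proj => x k P * proj_re P a b).
Proof. by apply: bounded_measurableM; exact: proj_re_bounded. Qed.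

Lemma bounded_measurable_diag_im k a b :
  bounded_measurable (fun P : proj => x k P * proj_im P a b).
Proof.
by apply: bounded_measurableM; [exact: proj_re_bounded|exact: proj_im_bounded].
Qed.

(** The phase [-1] on coordinate [a] flips the sign of [P_ab] and fixes [P_kk], so the mean equals
    its own opposite. *)
Lemma mean_diag_re k a b : a != b -> \int[mu]_P (x k P * proj_re P a b) = 0.
Proof.
move=> ab; have z1 : (-1 : R[i]) * (-1)^* = 1 by rewrite rmorphN1 mulrNN mulr1.
have bf := bounded_measurable_diag_re k a b.
have := mean_phase a b k (-1) z1 (fun u v _ => u * v) ab bf.
under [in X in _ = X -> _]eq_Rintegral => P _.
  rewrite /= oppr0 mul0r subr0 mulN1r mulrN -mulN1r. over.
by rewrite (meanZ mu (-1) _ bf) mulN1r; lra.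
Qed.

(** The same sign flip works off the diagonal; on it the imaginary part is zero. *)
Lemma mean_diag_im k a b : \int[mu]_P (x k P * proj_im P a b) = 0.
Proof.
have [->|ab] := eqVneq a b.
  rewrite -[RHS](mean_cst mu); apply: eq_Rintegral => P _.
  by rewrite proj_im_diag mulr0.
have z1 : (-1 : R[i]) * (-1)^* = 1 by rewrite rmorphN1 mulrNN mulr1.
have bf := bounded_measurable_diag_im k a b.
have := mean_phase a b k (-1) z1 (fun u _ w => u * w) ab bf.
under [in X in _ = X -> _]eq_Rintegral => P _.
  rewrite /= oppr0 mul0r addr0 mulN1r mulrN -mulN1r. over.
by rewrite (meanZ mu (-1) _ bf) mulN1r; lra.
Qed.

Definition diag_moment a b := \int[mu]_P (x a P * x b P).

(** The phase ['i] sends [Re P_ab] to [- Im P_ab], so both squares have the same mean, and they add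
    up to [P_aa P_bb]. *)
Lemma mean_re_sqr a b : a != b ->
  \int[mu]_P (proj_re P a b * proj_re P a b) = diag_moment a b / 2.
Proof.
move=> ab; have z1 : 'i%C * 'i%C^* = 1 :> R[i].
  by apply/eqP; rewrite eq_complex /=; apply/andP; split; apply/eqP; ring.
have bre : bounded_measurable
    (fun P : proj => proj_re P a b * proj_re P a b).
  by apply: bounded_measurableM; exact: proj_re_bounded.
have bim : bounded_measurable
    (fun P : proj => proj_im P a b * proj_im P a b).
  by apply: bounded_measurableM; exact: proj_im_bounded.
have := mean_phase a b a 'i%C z1 (fun _ v _ => v * v) ab bre.
under [in X in _ = X -> _]eq_Rintegral => P _.
  rewrite /= mul0r mul1r sub0r mulrNN. over.
move=> reim.
have : diag_moment a b = \int[mu]_P (proj_re P a b * proj_re P a b) +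
                         \int[mu]_P (proj_im P a b * proj_im P a b).
  rewrite -meanD//; apply: eq_Rintegral => P _.
  by rewrite -proj_re_im_sqr !expr2.
lra.
Qed.

Lemma diag_momentC a b : diag_moment a b = diag_moment b a.
Proof. by apply: eq_Rintegral => P _; rewrite mulrC. Qed.

(** Invariance of the mean of [P_aa^2] under the reflection reads [625 M_aa = 81 M_aa + 256 M_bb +
    (288 + 576/2) M_ab], with [M] the diagonal moments; dividing by 32 gives the coefficients. *)
Lemma diag_moment_reflection a b : a != b ->
  17 * diag_moment a a = 8 * diag_moment b b + 18 * diag_moment a b.
Proof.
move=> ab.
pose f (P : proj) := x a P * x a P.
have bre i j := proj_re_bounded (R := R) (d_gt1 := d_gt1) i j.
have bM i j k l : bounded_measurable
    (fun P : proj => proj_re P i j * proj_re P k l).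
  exact: bounded_measurableM.
have := mean_projector_conj _ (reflection_mx_unitary a b ab) f (bM a a a a).
(* The integrand is the square of [(9/25) P_aa + (16/25) P_bb - (24/25) Re P_ab]; its last two terms
   have mean zero. *)
have -> : \int[mu]_P f (projector_conj (reflection_mx_unitary a b ab) P) =
    \int[mu]_P (81 / 625 * (x a P * x a P) + (256 / 625 * (x b P * x b P) +
      (288 / 625 * (x a P * x b P) + (576 / 625 * (proj_re P a b * proj_re P a b) +
      (- (432 / 625) * (x a P * proj_re P a b) +
       - (768 / 625) * (x b P * proj_re P a b)))))).
  apply: eq_Rintegral => P _; rewrite /f /proj_re [projector_mx _ a a]reflection_mx_conjE//.
  rewrite !projector_mxE (proj_reC P a b) (proj_imC P a b) !proj_im_diag.
  (* The complex constants are rewritten as embedded reals so that the real part can be computed. *)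
  set c9 : R[i] := 9 / 25; set c16 : R[i] := 16 / 25; set c12 : R[i] := 12 / 25.
  have -> : c9 = (9 / 25)%:C%C by rewrite /c9 rmorphM fmorphV !rmorph_nat.
  have -> : c16 = (16 / 25)%:C%C by rewrite /c16 rmorphM fmorphV !rmorph_nat.
  have -> : c12 = (12 / 25)%:C%C by rewrite /c12 rmorphM fmorphV !rmorph_nat.
  by rewrite /=; field.
rewrite !meanD; do ?[exact: bounded_measurableZ|apply: bounded_measurableD].
rewrite !meanZ// !(mean_diag_re _ a b ab) (mean_re_sqr a b ab) /f.
rewrite -!/(diag_moment _ _).
rewrite -/(diag_moment a a); lra.
Qed.

(** Using the reflection identity in both orders gives [M_kk = M_ll = 2 M_kl], so a single constant
    [c] determines all moments; the trace fixes it. *)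
Lemma diag_momentE a b :
  diag_moment a b = (1 + (a == b)%:R) / (d%:R * (d%:R + 1)).
Proof.
pose c := diag_moment a a / 2.
have cE i j : diag_moment i j = c * (1 + (i == j)%:R).
  have E k l : k != l -> diag_moment k k = diag_moment l l /\
      diag_moment k k = 2 * diag_moment k l.
    move=> kl; have := diag_moment_reflection k l kl.
    rewrite eq_sym in kl; have := diag_moment_reflection l k kl.
    by rewrite (diag_momentC l k); lra.
  have Ei : diag_moment i i = 2 * c.
    have [->|/E[ia _]] := eqVneq i a; rewrite /c; lra.
  by have [<-|/E[_ ij]] := eqVneq i j; rewrite /=; lra.
rewrite cE.
have d0 : (d%:R : R) * (d%:R + 1) != 0.
  by rewrite mulf_neq0// ?natr1 pnatr_eq0// -lt0n ltnW.
suff cd : c * (d%:R * (d%:R + 1)) = 1.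
  rewrite mulrC; congr (_ * _).
  by apply: (mulIf d0); rewrite cd mulVf.
(* The sum of all moments is [c (d^2 + d)] on one side and the mean of the squared trace, which is
   1, on the other. *)
transitivity (\sum_i \sum_j diag_moment i j).
  under eq_bigr do under eq_bigr do rewrite cE.
  under eq_bigr => i _.
    rewrite -mulr_sumr big_split /= sumr_const card_ord (bigD1 i)//= eqxx.
    rewrite big1 ?addr0; last by move=> j /negbTE; rewrite eq_sym => ->.
    over.
  by rewrite sumr_const card_ord -[RHS]mulr_natr -[true%:R]/(1 : R); ring.
rewrite -[RHS](mean_cst mu).
transitivity (\sum_i \int[mu]_P (\sum_j x i P * x j P)).
  apply: eq_bigr => i _; rewrite mean_sum// => j.
  exact: bounded_measurable_diag_re.
rewrite -mean_sum; last first.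
  by move=> i; apply: bounded_measurable_sum => j; exact: bounded_measurable_diag_re.
apply: eq_Rintegral => P _.
under eq_bigr do rewrite -mulr_sumr proj_re_sum mulr1.
exact: proj_re_sum.
Qed.

End Moments.

(** * Second moment of a sum of independent centred variables *)

Section IndependentSum.
Context {d d' : measure_display} {T : measurableType d} {T' : measurableType d'}.
Context {R : realType}.
Variables (P : probability T R) (N : nat) (X : 'I_N -> {RV P >-> T'}).
Hypothesis X_indep : mutually_independent X.

Lemma mutually_independent_pair i j (A B : set T') : i != j ->
  measurable A -> measurable B ->
  P (X i @^-1` A `&` X j @^-1` B) = (P (X i @^-1` A) * P (X j @^-1` B))%E.
Proof.
move=> ij mA mB; pose F k := if k == i then A else B.
have ji : (j == i) = false by rewrite eq_sym (negbTE ij).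
have mF k : measurable (F k) by rewrite /F; case: ifP.
have := X_indep [set i; j]%SET F mF.
rewrite big_setU1 ?inE// big_set1 /F eqxx ji => <-; congr (P _).
apply/seteqP; split=> [w [iA jB] k /=|w H].
  by rewrite !inE => /orP[]/eqP ->; rewrite ?eqxx ?ji.
by split; [have := H i|have := H j]; rewrite /= !inE !eqxx ?ji ?orbT; exact.
Qed.

(** In the expanded square, each cross term factors by pairwise independence into a product of zero
    means; only the [N] diagonal terms remain. *)
Lemma mean_sqr_sum (f : T' -> R) (s : R) : bounded_measurable f ->
  (forall i, \int[P]_w f (X i w) = 0) ->
  (forall i, \int[P]_w (f (X i w) * f (X i w)) = s) ->
  \int[P]_w ((\sum_i f (X i w)) * (\sum_i f (X i w))) = N%:R * s.
Proof.
move=> bf f0 fs.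
have bX i : bounded_measurable (fun w => f (X i w)).
  exact: bounded_measurable_comp.
have bXX i j : bounded_measurable (fun w => f (X i w) * f (X j w)).
  exact: bounded_measurableM.
transitivity (\int[P]_w (\sum_i \sum_j f (X i w) * f (X j w))).
  apply: eq_Rintegral => w _; rewrite mulr_suml; apply: eq_bigr => i _.
  by rewrite mulr_sumr.
rewrite mean_sum => [|i]; last exact: bounded_measurable_sum.
transitivity (\sum_(i < N) s); last by rewrite sumr_const card_ord mulr_natl.
apply: eq_bigr => i _; rewrite mean_sum// (bigD1 i)//= fs big1 ?addr0// => j ji.
rewrite mean_mul_indep// ?f0 ?mul0r// => A B mA mB.
by apply: mutually_independent_pair => //; rewrite eq_sym.
Qed.

End IndependentSum.

(** * Entrywise formulas for the Frobenius norm and the state *)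

Section ComplexEntries.
Context {R : realType}.

Lemma Re_realM (c : R) (z : R[i]) : complex.Re (c%:C%C * z) = c * complex.Re z.
Proof. by case: z => x y /=; rewrite mul0r subr0. Qed.

Lemma Im_realM (c : R) (z : R[i]) : complex.Im (c%:C%C * z) = c * complex.Im z.
Proof. by case: z => x y /=; rewrite mul0r addr0. Qed.

Lemma frobenius_sqE d (M : 'M[R[i]]_d) :
  frobenius_sq M =
  \sum_a \sum_b (complex.Re (M a b) ^+ 2 + complex.Im (M a b) ^+ 2).
Proof.
rewrite /frobenius_sq /mxtrace raddf_sum exchange_big /=; apply: eq_bigr => b _.
rewrite mxE raddf_sum; apply: eq_bigr => a _ /=.
by rewrite !mxE; case: (M a b) => x y /=; ring.
Qed.

Lemma mxtrace_delta_mul d (k : 'I_d) (M : 'M[R[i]]_d) :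
  \tr (delta_mx k k *m M) = M k k.
Proof.
rewrite -(mul_delta_mx (0 : 'I_1)) -mulmxA mxtrace_mulC trace_mx11.
by rewrite -mulmxA -colE -rowE !mxE.
Qed.

Lemma equal_rank_stateE d r (a b : 'I_d) :
  equal_rank_state R d r a b = ((a == b)%:R * (a < r)%N%:R / r%:R)%:C%C.
Proof.
rewrite mxE summxE rmorphM fmorphV rmorphM !rmorph_nat mulrC; congr (_ / _).
rewrite (eq_bigr (fun i => ((a == i) && (b == i))%:R)) => [|i _]; last by rewrite mxE.
have [ar|ar] := boolP (a < r)%N.
  rewrite (bigD1 a)//= eqxx big1 ?addr0 ?mulr1 1?eq_sym// => i /andP[_ ia].
  by rewrite eq_sym (negbTE ia).
rewrite mulr0 big1// => i ir; case: eqVneq => // ai.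
by rewrite ai ir in ar.
Qed.

End ComplexEntries.

(** * First moments of the measurement outcome *)

Section CovariantMean.
Context {R : realType} {d : nat} {d_gt1 : (1 < d)%N}.
Local Notation proj := (projector R d_gt1).
Variables (mu nu : probability proj R) (r : nat).
Hypotheses (mu_inv : unitarily_invariant mu) (r_gt0 : (0 < r)%N) (r_le_d : (r <= d)%N).
Hypothesis nuE : forall A, measurable A ->
  nu A = covariant_law mu (equal_rank_state R d r) A.

(** These are the entries of [1 + rho], a real diagonal matrix. *)
Definition centering (a b : 'I_d) : R := (a == b)%:R * (1 + (a < r)%N%:R / r%:R).

Lemma covariant_density_equal_rank (P : proj) :
  covariant_density (equal_rank_state R d r) P =
  \sum_(k < d | (k < r)%N) d%:R / r%:R * proj_re P k k.
Proof.
rewrite /covariant_density /equal_rank_state -scalemxAl linearZ /=.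
rewrite (_ : r%:R^-1 = (r%:R^-1)%:C%C); last by rewrite fmorphV rmorph_nat.
rewrite Re_realM mulmx_suml (linear_sum (@mxtrace _ d)) raddf_sum /= mulrA mulr_sumr.
by apply: eq_bigr => k _; rewrite mxtrace_delta_mul.
Qed.

(** The density is a combination of diagonal entries, so a mean under the outcome law reduces to
    means under [mu], where unitary symmetry is available. *)
Lemma mean_covariant (f : proj -> R) : bounded_measurable f ->
  \int[nu]_P f P =
  \sum_(k < d | (k < r)%N) d%:R / r%:R * \int[mu]_P (proj_re P k k * f P).
Proof.
move=> bf; have bre k := proj_re_bounded (R := R) (d_gt1 := d_gt1) k k.
rewrite (mean_density mu nu (fun P => covariant_density (equal_rank_state R d r) P))//.
- transitivity (\int[mu]_P (\sum_(k < d | (k < r)%N)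
      d%:R / r%:R * (proj_re P k k * f P))).
    apply: eq_Rintegral => P _; rewrite covariant_density_equal_rank mulr_sumr.
    by apply: eq_bigr => k _; ring.
  rewrite mean_sum => [|k]; last exact/bounded_measurableZ/bounded_measurableM.
  by apply: eq_bigr => k _; rewrite meanZ//; exact: bounded_measurableM.
- rewrite (_ : (fun=> _) = fun P => \sum_(k < d | (k < r)%N) d%:R / r%:R * proj_re P k k).
    by apply: bounded_measurable_sum => k; exact: bounded_measurableZ.
  by apply/funext => P; exact: covariant_density_equal_rank.
Qed.

Lemma mean_covariant_im a b : \int[nu]_P proj_im P a b = 0.
Proof.
rewrite mean_covariant; last exact: proj_im_bounded.
by rewrite big1// => k _; rewrite mean_diag_im// mulr0.
Qed.

Lemma mean_covariant_re a b :
  (d%:R + 1) * \int[nu]_P proj_re P a b = centering a b.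
Proof.
rewrite mean_covariant; last exact: proj_re_bounded.
rewrite /centering; have [<-{b}|ab] := eqVneq a b; last first.
  by rewrite mul0r big1 ?mulr0// => k _; rewrite mean_diag_re// mulr0.
have d0 : (d%:R : R) != 0 by rewrite pnatr_eq0 -lt0n ltnW.
have d1 : (d%:R + 1 : R) != 0 by rewrite natr1 pnatr_eq0.
have r0 : (r%:R : R) != 0 by rewrite pnatr_eq0 -lt0n.
(* The factor [d / r] of the density cancels the [d] in the denominator of the second moment. *)
rewrite (eq_bigr (fun k : 'I_d => (r%:R * (d%:R + 1))^-1 * (1 + (k == a)%:R))); last first.
  move=> k _; rewrite -/(diag_moment mu k a) diag_momentE//.
  by field; rewrite d0 d1 r0.
rewrite -mulr_sumr big_split /= sumr_const.
have -> : #|[pred k : 'I_d | (k < r)%N]| = r.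
  by rewrite -sum1_card (big_ord_narrow r_le_d) sum1_card card_ord.
have -> : \sum_(k < d | (k < r)%N) (k == a)%:R = (a < r)%N%:R :> R.
  rewrite big_mkcond (bigD1 a)//= eqxx big1 ?addr0; first by case: ifP.
  by move=> k /negbTE ->; case: ifP.
by field; rewrite d1 r0.
Qed.

End CovariantMean.

(** * Error of the estimator and its total variance *)

Section LeastSquares.
Context {R : realType} {d : nat} {d_gt1 : (1 < d)%N}.
Local Notation proj := (projector R d_gt1).
Variable r : nat.
Hypotheses (r_gt0 : (0 < r)%N) (r_le_d : (r <= d)%N).

(** Real and imaginary parts of the entries of [(d+1) P - 1 - rho], the error of a single
    outcome. *)
Definition error_re (a b : 'I_d) (P : proj) : R :=
  (d%:R + 1) * proj_re P a b - centering r a b.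
Definition error_im (a b : 'I_d) (P : proj) : R := (d%:R + 1) * proj_im P a b.

Lemma error_re_bounded a b : bounded_measurable (error_re a b).
Proof.
apply: bounded_measurableB; last exact: bounded_measurable_cst.
exact/bounded_measurableZ/proj_re_bounded.
Qed.

Lemma error_im_bounded a b : bounded_measurable (error_im a b).
Proof. exact/bounded_measurableZ/proj_im_bounded. Qed.

(** This is the squared Frobenius norm of [1 + rho], that is [d + 2 tr rho + tr rho^2]. *)
Lemma sum_centering_sqr :
  \sum_(a < d) \sum_(b < d) centering r a b ^+ 2 = d%:R + 2 + r%:R^-1 :> R.
Proof.
have r0 : (r%:R : R) != 0 by rewrite pnatr_eq0 -lt0n.
rewrite (eq_bigr (fun a : 'I_d => 1 + (a < r)%N%:R * (2 / r%:R + r%:R^-1 ^+ 2))).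
  rewrite big_split /= sumr_const card_ord -mulr_suml -natr_sum.
  have -> : (\sum_(i < d) (i < r)%N)%N = r.
    by rewrite -big_mkcond (big_ord_narrow r_le_d) sum1_card card_ord.
  by field.
move=> a _; rewrite (bigD1 a)//= big1 ?addr0 => [|b ba].
  by rewrite /centering eqxx /=; case: (a < r)%N => /=; field.
by rewrite /centering eq_sym (negbTE ba) mul0r expr0n.
Qed.

Section Variance.
Variables (mu nu : probability proj R).
Hypothesis mu_inv : unitarily_invariant mu.
Hypothesis nuE : forall A, measurable A ->
  nu A = covariant_law mu (equal_rank_state R d r) A.

Lemma mean_error_re a b : \int[nu]_P error_re a b P = 0.
Proof.
have bre := proj_re_bounded (R := R) (d_gt1 := d_gt1) a b.
rewrite /error_re meanB; [|exact: bounded_measurableZ|exact: bounded_measurable_cst].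
by rewrite meanZ// (mean_covariant_re mu nu r)// mean_cst subrr.
Qed.

Lemma mean_error_im a b : \int[nu]_P error_im a b P = 0.
Proof.
have bim := proj_im_bounded (R := R) (d_gt1 := d_gt1) a b.
by rewrite /error_im meanZ// (mean_covariant_im mu nu r)// mulr0.
Qed.

(** A variance is a second moment minus the square of the mean: [(d+1) P] has squared norm [(d+1)^2]
    for every projector, and its mean is [1 + rho]. *)
Lemma total_variance :
  \sum_a \sum_b (\int[nu]_P (error_re a b P * error_re a b P) +
                 \int[nu]_P (error_im a b P * error_im a b P)) =
  (d%:R + 1) ^+ 2 - (d%:R + 2 + r%:R^-1).
Proof.
have bre a b := proj_re_bounded (R := R) (d_gt1 := d_gt1) a b.
have bim a b := proj_im_bounded (R := R) (d_gt1 := d_gt1) a b.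
have bsq a b : bounded_measurable (fun P : proj =>
    proj_re P a b * proj_re P a b + proj_im P a b * proj_im P a b).
  by apply: bounded_measurableD; exact: bounded_measurableM.
have bsqs a : bounded_measurable (fun P : proj =>
    \sum_b (proj_re P a b * proj_re P a b + proj_im P a b * proj_im P a b)).
  exact: bounded_measurable_sum.
rewrite -sum_centering_sqr.
transitivity (\sum_a \sum_b ((d%:R + 1) ^+ 2 * \int[nu]_P
    (proj_re P a b * proj_re P a b + proj_im P a b * proj_im P a b)
    - centering r a b ^+ 2)).
  apply: eq_bigr => a _; apply: eq_bigr => b _.
  have c := mean_covariant_re mu nu r mu_inv r_gt0 r_le_d nuE a b.
  transitivity (\int[nu]_P ((d%:R + 1) ^+ 2 *
      (proj_re P a b * proj_re P a b + proj_im P a b * proj_im P a b) -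
      (2 * centering r a b * (d%:R + 1)) * proj_re P a b + centering r a b ^+ 2)).
    rewrite -meanD; last 2 first.
    - by apply: bounded_measurableM; exact: error_re_bounded.
    - by apply: bounded_measurableM; exact: error_im_bounded.
    by apply: eq_Rintegral => P _; rewrite /error_re /error_im; ring.
  rewrite meanD; last 2 first.
  - by apply: bounded_measurableB; exact: bounded_measurableZ.
  - exact: bounded_measurable_cst.
  rewrite meanB; [|exact: bounded_measurableZ..].
  rewrite meanZ// [in X in _ - X]meanZ// mean_cst -mulrA c; ring.
under eq_bigr do rewrite sumrB -mulr_sumr.
rewrite sumrB -mulr_sumr; congr (_ - _).
(* Pointwise, the [|P_ab|^2 = P_aa P_bb] sum to the squared trace, which is 1. *)
rewrite -[RHS]mulr1; congr (_ * _); rewrite -[RHS](mean_cst nu).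
transitivity (\int[nu]_P \sum_a \sum_b
    (proj_re P a b * proj_re P a b + proj_im P a b * proj_im P a b)).
  by rewrite mean_sum//; apply: eq_bigr => a _; rewrite mean_sum.
apply: eq_Rintegral => P _.
under eq_bigr => a _.
  under eq_bigr do rewrite -!expr2 proj_re_im_sqr.
  rewrite -mulr_sumr proj_re_sum mulr1. over.
exact: proj_re_sum.
Qed.

End Variance.

(** Since [N] is nonzero, [rho] can be distributed over the [N] summands, which makes the total
    error the average of the single errors. *)
Lemma ls_estimator_errorE N (P : 'I_N -> proj) a b : (0 < N)%N ->
  (ls_estimator P - equal_rank_state R d r) a b =
  ((N%:R^-1 * \sum_i error_re a b (P i)) +i* (N%:R^-1 * \sum_i error_im a b (P i)))%C.
Proof.
move=> N_gt0.
have N0 : (N%:R : R) != 0 by rewrite pnatr_eq0 -lt0n.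
have r0 : (r%:R : R) != 0 by rewrite pnatr_eq0 -lt0n.
have d1 : (d%:R + 1 : R) != 0 by rewrite natr1 pnatr_eq0.
have dE : d.+1%:R^-1 = ((d%:R + 1)^-1)%:C%C :> R[i].
  by rewrite fmorphV natr1 rmorph_nat.
rewrite [LHS]mxE [X in _ + X]mxE equal_rank_stateE [X in X - _]mxE summxE.
have -> : d.+1%:R / N%:R = ((d%:R + 1) / N%:R)%:C%C :> R[i].
  by rewrite rmorphM fmorphV natr1 !rmorph_nat.
rewrite (eq_bigr (fun i => ((proj_re (P i) a b - (a == b)%:R / (d%:R + 1)) +i*
                            proj_im (P i) a b)%C)) => [|i _]; last first.
  rewrite !mxE projector_mxE dE; case: (a == b).
    by rewrite mulr1n mul1r; congr (_ +i* _)%C; rewrite oppr0 addr0.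
  by rewrite mulr0n mul0r !subr0.
set z := \sum_(i < N) _.
apply/eqP; rewrite eq_complex; apply/andP; split; apply/eqP.
  rewrite raddfB /= Re_realM /z raddf_sum /= sumrB sumr_const card_ord.
  rewrite /error_re sumrB -mulr_sumr sumr_const card_ord /centering.
  rewrite -[(_ / _) *+ N]mulr_natr -[(_ * (1 + _)) *+ N]mulr_natr.
  by field; rewrite N0 d1 r0.
rewrite raddfB /= Im_realM /z raddf_sum /= subr0 /error_im -mulr_sumr.
by rewrite mulrA [_ / _]mulrC.
Qed.

End LeastSquares.

(** * Mean squared error of the least squares estimator *)

Theorem mainTheorem1 (R : realType) (d r N : nat)
    (d_gt1 : (2 <= d)%N) (r_gt0 : (1 <= r)%N) (r_le_d : (r <= d)%N)
    (N_gt0 : (1 <= N)%N)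
    (mu : probability (projector R d_gt1) R)
    (mu_inv : unitarily_invariant mu)
    (disp : measure_display) (Omega : measurableType disp)
    (Pr : probability Omega R)
    (P : 'I_N -> {RV Pr >-> projector R d_gt1})
    (P_indep : mutually_independent P)
    (P_law : forall (i : 'I_N) (A : set (projector R d_gt1)), measurable A ->
       distribution Pr (P i) A = covariant_law mu (equal_rank_state R d r) A) :
  (N%:R%:E * 'E_Pr[fun w => frobenius_sq
     (ls_estimator (fun i => P i w) - equal_rank_state R d r)])%E =
  ((r%:R + 1) * (r%:R + 2) * ((d%:R + 1) / (d%:R + 2))
   - (r%:R + 1) ^+ 2 / r%:R
   + 2 * ((r%:R + 1) * (d%:R - r%:R) * (d%:R + 1) / (d%:R + 2))
   + (d%:R - r%:R) * (d%:R - r%:R - 1) * (d%:R + 1) / (d%:R + 2)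
   + (d%:R - r%:R) * d%:R / (d%:R + 2))%:E.
Proof.
have N0 : (N%:R : R) != 0 by rewrite pnatr_eq0 -lt0n.
have r0 : (r%:R : R) != 0 by rewrite pnatr_eq0 -lt0n.
have d2 : (d%:R + 2 : R) != 0 by rewrite -natrD pnatr_eq0 addn2.
(* The law of the first outcome, which exists because [N] is positive, serves as the common law: all
   outcomes have the same density with respect to [mu]. *)
pose nu := distribution Pr (P (Ordinal N_gt0)).
have nuE := P_law (Ordinal N_gt0).
have same_mean i (f : projector R d_gt1 -> R) : bounded_measurable f ->
    \int[Pr]_w f (P i w) = \int[nu]_Q f Q.
  move=> bf; rewrite mean_distribution//.
  by rewrite (mean_covariant mu _ r (P_law i))// (mean_covariant mu nu r nuE).
have sum_sqr (f : projector R d_gt1 -> R) : bounded_measurable f ->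
    \int[nu]_Q f Q = 0 ->
    \int[Pr]_w ((\sum_i f (P i w)) * (\sum_i f (P i w))) =
    N%:R * \int[nu]_Q (f Q * f Q).
  move=> bf f0; apply: mean_sqr_sum => // i; first by rewrite same_mean.
  by rewrite (same_mean i (fun Q => f Q * f Q))//; exact: bounded_measurableM.
have bsum (f : projector R d_gt1 -> R) : bounded_measurable f ->
    bounded_measurable (fun w => (\sum_i f (P i w)) * (\sum_i f (P i w))).
  move=> bf; have bs : bounded_measurable (fun w => \sum_i f (P i w)).
    by apply: bounded_measurable_sum => i; exact: bounded_measurable_comp.
  exact: bounded_measurableM.
pose sq (f : projector R d_gt1 -> R) w : R := (\sum_i f (P i w)) * (\sum_i f (P i w)).
(* [F a b] is the squared modulus of the entry [(a, b)] of the total error; [N^-2] comes from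
   averaging. *)
pose F (a b : 'I_d) w := N%:R^-1 ^+ 2 *
  (sq (error_re r a b) w + sq (error_im (d_gt1 := d_gt1) a b) w).
have bre (a b : 'I_d) := bsum _ (error_re_bounded (R := R) (d_gt1 := d_gt1) r a b).
have bim (a b : 'I_d) := bsum _ (error_im_bounded (R := R) (d_gt1 := d_gt1) a b).
have bF a b : bounded_measurable (F a b).
  apply: bounded_measurableZ.
  exact: (bounded_measurableD _ _ (bre a b) (bim a b)).
have bFs a : bounded_measurable (fun w => \sum_b F a b w).
  exact: bounded_measurable_sum.
rewrite unlock (_ : (fun w => _) = fun w => (\sum_a \sum_b F a b w)%:E); last first.
  apply/funext => w /=; congr EFin; rewrite frobenius_sqE.
  apply: eq_bigr => a _; apply: eq_bigr => b _.
  by rewrite ls_estimator_errorE//= /F /sq; ring.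
rewrite mean_EFin; last exact: bounded_measurable_sum.
rewrite -EFinM; congr EFin.
(* Each squared sum has mean [N] times that of a single error, so [N^-2] becomes [N^-1]. *)
have -> : \int[Pr]_w (\sum_a \sum_b F a b w) = N%:R^-1 *
    \sum_a \sum_b (\int[nu]_Q (error_re r a b Q * error_re r a b Q) +
                   \int[nu]_Q (error_im a b Q * error_im a b Q)).
  rewrite mean_sum// mulr_sumr; apply: eq_bigr => a _.
  rewrite mean_sum// mulr_sumr; apply: eq_bigr => b _.
  rewrite /F /sq meanZ; last exact: (bounded_measurableD _ _ (bre a b) (bim a b)).
  rewrite (meanD _ _ _ (bre a b) (bim a b)).
  rewrite (sum_sqr _ (error_re_bounded r a b)
                     (mean_error_re r r_gt0 r_le_d mu nu mu_inv nuE a b)).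
  rewrite (sum_sqr _ (error_im_bounded a b)
                     (mean_error_im r mu nu mu_inv nuE a b)).
  by field.
rewrite (total_variance _ _ _ mu nu)//.
(* The remaining [N^-1] cancels the factor [N] of the statement, and the two expressions in [d] and
   [r] agree as rational functions. *)
by field; rewrite N0 r0 d2.
Qed.
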